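(* Let $X,Y,Z\in\mathbb{E}$ and let $\varphi$ be a predicate. Then (1) $X\star\max\{Y,Z\}=\max\{X\star Y,\ X\star Z\}$; (2) $X\star(Y+Z)\preceq X\star Y+X\star Z$; (3) $[\varphi]\star(Y\cdot Z)\preceq([\varphi]\star Y)\cdot([\varphi]\star Z)$. Furthermore, if $X$ and $[\varphi]$ are domain-exact, then (4) $X\star(Y+Z)=X\star Y+X\star Z$; (5) $[\varphi]\star(Y\cdot Z)=([\varphi]\star Y)\cdot([\varphi]\star Z)$.
   Context: States are pairs $(s,h)$ of a stack $s:\mathrm{Vars}\to\mathbb{Z}$ and a heap $h$, i.e. a map $h:N\to\mathbb{Z}$ with $N=\mathrm{dom}(h)\subseteq\mathbb{N}_{>0}$ finite; $\Sigma$ is the set of states. Disjoint heaps $h_1,h_2$ (disjoint domains) have union $h_1\star h_2$. $\mathbb{E}$ is the set of functions $\Sigma\to\mathbb{R}_{\ge0}\cup\{\infty\}$, ordered pointwise by $\preceq$; $+$, $\cdot$, $\max$ are taken pointwise, with $0\cdot\infty=0$. For a predicate $\varphi$ on states, $[\varphi]$ is its $\{0,1\}$-valued indicator. $(X\star Y)(s,h)=\max\{X(s,h_1)\cdot Y(s,h_2)\mid h=h_1\star h_2\}$. An expectation $X$ is domain-exact if for every stack $s$ and heaps $h,h'$, $X(s,h)>0$ and $X(s,h')>0$ imply $\mathrm{dom}(h)=\mathrm{dom}(h')$. *)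

(* Defs.v *)
From mathcomp Require Import all_boot all_order all_algebra finmap.
From mathcomp Require Import all_classical all_reals ereal numfun.

Set Implicit Arguments.
Unset Strict Implicit.
Unset Printing Implicit Defensive.

Import Order.TTheory GRing.Theory Num.Theory.
Local Open Scope classical_set_scope.
Local Open Scope ereal_scope.

Notation loc := {n : nat | (0 < n)%N}.

Definition heap : Type := {fmap loc -> int}.

Definition stack (Vars : Type) : Type := Vars -> int.

Definition state (Vars : Type) : Type := (stack Vars * heap)%type.

Definition heap_disjoint (h1 h2 : heap) : Prop :=
  [disjoint domf h1 & domf h2]%fset.

(* [h1 + h2] on finite maps is right-biased, hence the plain union as soon as
   the domains are disjoint. *)
Definition heap_split (h h1 h2 : heap) : Prop :=
  heap_disjoint h1 h2 /\ h = (h1 + h2)%fset.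

Definition is_expectation (R : realType) (Vars : Type) :
    set (state Vars -> \bar R) :=
  [set X | forall st, 0 <= X st].

Definition exp_le (R : realType) (Vars : Type) (X Y : state Vars -> \bar R) :
    Prop :=
  forall st, X st <= Y st.

Definition iverson (R : realType) (Vars : Type) (phi : set (state Vars)) :
    state Vars -> \bar R :=
  fun st => (\1_phi st)%:E.

(* The set ranges over the finitely many splits of a heap, so the supremum is a
   maximum: see [sepcon_attained]. *)
Definition sepcon (R : realType) (Vars : Type) (X Y : state Vars -> \bar R) :
    state Vars -> \bar R :=
  fun st => ereal_sup [set e | exists h1 h2 : heap,
    heap_split st.2 h1 h2 /\ e = X (st.1, h1) * Y (st.1, h2)].

Definition domain_exact (R : realType) (Vars : Type)
    (X : state Vars -> \bar R) : Prop :=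
  forall (s : stack Vars) (h h' : heap),
    0 < X (s, h) -> 0 < X (s, h') -> domf h = domf h'.

Lemma heap_split_restrict (h : heap) (A : {fset loc}) :
  (A `<=` domf h)%fset -> heap_split h h.[& A]%fmap h.[\ A]%fmap.
Proof.
move=> sA; split.
  apply/fdisjointP => k; rewrite !mem_restrictf !inE => /andP[kA _].
  by rewrite kA.
apply/fmapP => k; rewrite fnd_cat mem_restrictf !fnd_restrict !inE.
case: (boolP (k \in A)) => //= kA.
by case: (boolP (k \in domf h)) => //= kh; rewrite not_fnd.
Qed.

Lemma heap_splitE (h h1 h2 : heap) : heap_split h h1 h2 ->
  [/\ (domf h1 `<=` domf h)%fset, h1 = h.[& domf h1]%fmap
    & h2 = h.[\ domf h1]%fmap].
Proof.
case=> /fdisjointP d12 ->; split.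
- by apply/fsubsetP => k k1; rewrite mem_catf k1.
- apply/fmapP => k; rewrite fnd_restrict fnd_cat.
  case: ifPn => k1; last by rewrite not_fnd.
  by rewrite (negPf (d12 _ k1)).
- apply/fmapP => k; rewrite fnd_restrict fnd_cat !inE.
  case: (boolP (k \in domf h1)) => k1 /=.
    by rewrite not_fnd ?d12.
  by case: (boolP (k \in domf h2)) => k2 //=; rewrite ?orbT ?not_fnd ?if_same.
Qed.

Lemma sepcon_attained (R : realType) (Vars : Type)
    (X Y : state Vars -> \bar R) (s : stack Vars) (h : heap) :
  exists h1 h2 : heap,
    heap_split h h1 h2 /\ sepcon X Y (s, h) = X (s, h1) * Y (s, h2).
Proof.
pose T := fpowerset (domf h).
have T0 : fset0 \in T by rewrite fpowersetE fsub0set.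
pose F (A : T) := X (s, h.[& val A]%fmap) * Y (s, h.[\ val A]%fmap).
have [A _ Amax] := @arg_maxP _ _ _ [` T0]%fset xpredT F isT.
have hA : heap_split h h.[& val A]%fmap h.[\ val A]%fmap.
  by apply: heap_split_restrict; rewrite -fpowersetE; exact: (valP A).
exists h.[& val A]%fmap, h.[\ val A]%fmap; split=> //.
apply/eqP; rewrite eq_le; apply/andP; split; last first.
  by apply: ereal_sup_ubound; eexists; eexists; split; [exact: hA|].
apply: ge_ereal_sup => _ [h1 [h2 [/= hs ->]]].
have [sd e1 e2] := heap_splitE hs.
have Td : domf h1 \in T by rewrite fpowersetE.
by have := Amax [` Td]%fset isT; rewrite /F /= -e1 -e2.
Qed.

(* Main.v *)
Require Import Defs.
From mathcomp Require Import all_boot all_order all_algebra finmap.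
From mathcomp Require Import all_classical all_reals ereal numfun.

Import Order.TTheory GRing.Theory Num.Theory.
Local Open Scope classical_set_scope.
Local Open Scope ereal_scope.

(** Evaluating at a split attaining the left-hand maximum gives (2), (3) and one
    half of (1), since multiplication by a nonnegative number distributes over
    [max] and [+], and an indicator is idempotent; the other half of (1) is
    monotonicity.  If [X] is domain-exact, all splits [(h1, h2)] of [h] with
    [X (s, h1) > 0] coincide, so a single split attains both [sepcon X Y] and
    [sepcon X Z]; this yields the equalities (4) and (5). *)

Section Sepcon.
Context {R : realType} {Vars : Type}.
Implicit Types (X Y Z : state Vars -> \bar R) (s : stack Vars) (h : heap).

Lemma sepcon_ubound X Y s h h1 h2 : heap_split h h1 h2 ->
  X (s, h1) * Y (s, h2) <= sepcon X Y (s, h).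
Proof. by move=> hs; apply: ereal_sup_ubound; exists h1, h2. Qed.

Lemma le_sepconr X Y Z : is_expectation X -> exp_le Y Z ->
  exp_le (sepcon X Y) (sepcon X Z).
Proof.
move=> X0 YZ [s h]; have [h1 [h2 [hs ->]]] := sepcon_attained X Y s h.
by apply: le_trans (sepcon_ubound X Z s _ _ _ hs); rewrite lee_wpmul2l.
Qed.

Lemma iverson_ge0 (phi : set (state Vars)) : is_expectation (iverson R phi).
Proof. by move=> st; rewrite lee_fin indicE. Qed.

(** An indicator takes only the values 0 and 1; in the zero case both sides vanish even for infinite
    [x] or [y], as 0 times infinity is 0. *)
Lemma iverson_mule (phi : set (state Vars)) st (x y : \bar R) :
  iverson R phi st * (x * y) = iverson R phi st * x * (iverson R phi st * y).
Proof.
by rewrite /iverson indicE; case: (st \in phi); rewrite ?mul1e ?mul0e.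
Qed.

(** Both components of a split are restrictions of [h], to the domain of the first and to its
    complement, so this domain determines the split. *)
Lemma heap_split_inj h h1 h2 h1' h2' :
  heap_split h h1 h2 -> heap_split h h1' h2' -> domf h1 = domf h1' ->
  h1 = h1' /\ h2 = h2'.
Proof.
move=> /heap_splitE[_ e1 e2] /heap_splitE[_ e1' e2'] ed.
by rewrite e1 e2 e1' e2' ed.
Qed.

Lemma sepcon_attained2 X Y Z s h :
  is_expectation X -> is_expectation Y -> is_expectation Z ->
  domain_exact X ->
  exists h1 h2, [/\ heap_split h h1 h2,
    sepcon X Y (s, h) = X (s, h1) * Y (s, h2) &
    sepcon X Z (s, h) = X (s, h1) * Z (s, h2)].
Proof.
move=> X0 Y0 Z0 exX.
have [h1 [h2 [hs eY]]] := sepcon_attained X Y s h.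
have [k1 [k2 [ks eZ]]] := sepcon_attained X Z s h.
(* If [X] vanishes at the first split, the maximum [sepcon X Y (s, h)] is 0; all products being
   nonnegative, every split attains it, in particular the one chosen for [Z]. *)
have [Xh|Xh] := eqVneq (X (s, h1)) 0.
  exists k1, k2; split => //; apply/eqP; rewrite eq_le sepcon_ubound// andbT.
  by rewrite eY Xh mul0e mule_ge0.
have [Xk|Xk] := eqVneq (X (s, k1)) 0.
  exists h1, h2; split => //; apply/eqP; rewrite eq_le sepcon_ubound// andbT.
  by rewrite eZ Xk mul0e mule_ge0.
(* Both values of [X] are now positive, so domain-exactness makes the two splits coincide. *)
have ed : domf h1 = domf k1 by apply: (exX s); rewrite lt0e ?Xh ?Xk X0.
have [e1 e2] := heap_split_inj _ _ _ _ _ hs ks ed.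
by exists h1, h2; split; rewrite // eZ e1 e2.
Qed.

Lemma sepcon_max X Y Z : is_expectation X ->
  sepcon X (Y \max Z)%function = (sepcon X Y \max sepcon X Z)%function.
Proof.
move=> X0; apply/funext => -[s h]; apply/eqP; rewrite eq_le; apply/andP; split.
  have [h1 [h2 [hs ->]]] := sepcon_attained X (Y \max Z)%function s h.
  rewrite /= le_max.
  (* At this split the [max] is one of its two arguments. *)
  have [_|_] := leP (Y (s, h2)) (Z (s, h2)); apply/orP; [right|left];
    exact: sepcon_ubound.
rewrite /= ge_max; apply/andP.
by split; apply: le_sepconr => // st; rewrite /= le_max lexx ?orbT.
Qed.

Lemma sepconD_le X Y Z :
  is_expectation X -> is_expectation Y -> is_expectation Z ->
  exp_le (sepcon X (Y \+ Z)) (sepcon X Y \+ sepcon X Z).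
Proof.
move=> X0 Y0 Z0 [s h].
have [h1 [h2 [hs ->]]] := sepcon_attained X (Y \+ Z) s h.
(* Nonnegativity of [Y] and [Z] rules out adding opposite infinities, so the product distributes. *)
by rewrite /= ge0_muleDr// leeD// sepcon_ubound.
Qed.

Lemma sepcon_iversonM_le (phi : set (state Vars)) Y Z :
  is_expectation Y -> is_expectation Z ->
  exp_le (sepcon (iverson R phi) (Y \* Z))
    (sepcon (iverson R phi) Y \* sepcon (iverson R phi) Z).
Proof.
move=> Y0 Z0 [s h].
have [h1 [h2 [hs ->]]] := sepcon_attained (iverson R phi) (Y \* Z) s h.
have p0 := iverson_ge0 phi.
by rewrite /= iverson_mule lee_pmul ?mule_ge0// sepcon_ubound.
Qed.

Lemma sepconD X Y Z :
  is_expectation X -> is_expectation Y -> is_expectation Z ->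
  domain_exact X -> sepcon X (Y \+ Z) = sepcon X Y \+ sepcon X Z.
Proof.
move=> X0 Y0 Z0 exX; apply/funext => -[s h].
apply/eqP; rewrite eq_le sepconD_le//=.
have [h1 [h2 [hs -> ->]]] := sepcon_attained2 X Y Z s h X0 Y0 Z0 exX.
(* At the common split the right-hand side factors into a single product, a candidate for the
   supremum on the left. *)
by rewrite -ge0_muleDr//; apply: (sepcon_ubound X (Y \+ Z)).
Qed.

Lemma sepcon_iversonM (phi : set (state Vars)) Y Z :
  is_expectation Y -> is_expectation Z -> domain_exact (iverson R phi) ->
  sepcon (iverson R phi) (Y \* Z) =
    sepcon (iverson R phi) Y \* sepcon (iverson R phi) Z.
Proof.
move=> Y0 Z0 exp; apply/funext => -[s h].
apply/eqP; rewrite eq_le sepcon_iversonM_le//=.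
have [h1 [h2 [hs -> ->]]] :=
  sepcon_attained2 _ Y Z s h (iverson_ge0 phi) Y0 Z0 exp.
(* Idempotence merges the two indicator factors, again leaving one such candidate. *)
by rewrite -iverson_mule; apply: (sepcon_ubound _ (Y \* Z)).
Qed.

End Sepcon.

Theorem theorem3p6 (R : realType) (Vars : Type)
    (X Y Z : state Vars -> \bar R) (phi : set (state Vars))
    (hX : is_expectation X) (hY : is_expectation Y) (hZ : is_expectation Z) :
  [/\ sepcon X (Y \max Z)%function = (sepcon X Y \max sepcon X Z)%function,
      exp_le (sepcon X (Y \+ Z)) (sepcon X Y \+ sepcon X Z),
      exp_le (sepcon (iverson R phi) (Y \* Z))
        (sepcon (iverson R phi) Y \* sepcon (iverson R phi) Z)
    & domain_exact X -> domain_exact (iverson R phi) ->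
      sepcon X (Y \+ Z) = (sepcon X Y \+ sepcon X Z) /\
      sepcon (iverson R phi) (Y \* Z) =
        (sepcon (iverson R phi) Y \* sepcon (iverson R phi) Z)].
Proof.
split; [exact: sepcon_max|exact: sepconD_le|exact: sepcon_iversonM_le|].
by move=> exX exphi; split; [exact: sepconD|exact: sepcon_iversonM].
Qed.
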